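(* Let $n\ge 2$ be an integer, let $b,c_1,c_2$ be integers, and let $T_n$ be the $(2^n-1)\times(2^n-1)$ matrix presentation of the linear cellular automaton $T_f$ with local rule $f(x_0,x_1,x_2)=bx_0+c_1x_1+c_2x_2 \pmod m$ defined on $\mathcal{T}_n$ (binary tree) with periodic boundary condition. Then $$\det T_n=(-1)^{2^n-n-1}(b+c_1+c_2)\,b^{2^n-n-1}\left[\sum_{j=0}^{n-1}(-1)^{j}(c_1+c_2)^{n-1-j}b^{j}\right].$$
   Context: Let $m\ge 2$, $\mathcal{A}=\{0,1,\dots,m-1\}$ (identified with $\mathbb{Z}_m$), $\Sigma=\{1,2\}$, and let $\Sigma_{n-1}=\bigcup_{k=0}^{n-1}\Sigma^k$ be the set of words over $\Sigma$ of length at most $n-1$ (the nodes of the binary tree of height $n$; the empty word $\epsilon$ is the root). Let $\mathcal{T}_n=\mathcal{A}^{\Sigma_{n-1}}$. The linear cellular automaton with periodic boundary condition $T_f:\mathcal{T}_n\to\mathcal{T}_n$ is given by $(T_ft)_x=f(t_x,t_{x1},t_{x2})$ if $|x|\le n-2$ and $(T_ft)_x=f(t_x,t_\epsilon,t_\epsilon)$ if $|x|=n-1$, where $f(x_0,x_1,x_2)=bx_0+c_1x_1+c_2x_2\pmod m$. Ordering the nodes by length and then lexicographically, the matrix presentation of $T_f$ is the $(2^n-1)\times(2^n-1)$ matrix $T_n$ with entries $T_n(i,j)=b$ if $j=i$, $1\le i\le 2^n-1$; $T_n(i,j)=c_1$ if $j=2i$, $1\le i\le 2^{n-1}-1$;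 $T_n(i,j)=c_2$ if $j=2i+1$, $1\le i\le 2^{n-1}-1$; $T_n(i,j)=c_1+c_2$ if $j=1$, $2^{n-1}\le i\le 2^n-1$; and $T_n(i,j)=0$ otherwise. *)

(* Defs.v *)
From HB Require Import structures.
From mathcomp Require Import all_boot all_order all_algebra.
From mathcomp Require Import zify.

Set Implicit Arguments.
Unset Strict Implicit.
Unset Printing Implicit Defensive.

Import Order.TTheory GRing.Theory Num.Theory.
Local Open Scope ring_scope.

(* Entries are indexed from 0 by 'I_(2 ^ n - 1); i and j below are the usual
   1-based row and column numbers.  The entries are integers: the matrix of the
   automaton over Z/m is the reduction of this one (lemma tree_caE below).     *)
Definition tree_ca_mx (n : nat) (b c1 c2 : int) : 'M[int]_(2 ^ n - 1)%N :=
  \matrix_(i0, j0)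
    let i := i0.+1 in
    let j := j0.+1 in
    if (j == i)%N then b
    else if (j == 2 * i)%N && (i <= 2 ^ n.-1 - 1)%N then c1
    else if (j == (2 * i).+1)%N && (i <= 2 ^ n.-1 - 1)%N then c2
    else if (j == 1)%N && (2 ^ n.-1 <= i)%N then c1 + c2
    else 0.

(* Words of length at most n - 1 over Sigma = {1, 2}; false stands for the
   letter 1 and true for the letter 2.                                         *)
Definition node (n : nat) := {bseq n.-1 of bool}.

Definition root n : node n := [bseq].

(* The empty word when the child would be too long. *)
Definition child n (x : node n) (a : bool) : node n :=
  insub_bseq n.-1 (rcons x a).

Definition config (m n : nat) := {ffun node n -> 'Z_m}.

Definition local_rule m (b c1 c2 : int) (x0 x1 x2 : 'Z_m) : 'Z_m :=
  b%:~R * x0 + c1%:~R * x1 + c2%:~R * x2.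

Definition tree_ca m n (b c1 c2 : int) (t : config m n) : config m n :=
  [ffun x : node n =>
     if (size x < n.-1)%N
     then local_rule b c1 c2 (t x) (t (child x false)) (t (child x true))
     else local_rule b c1 c2 (t x) (t (root n)) (t (root n))].

(* The number with binary expansion 1x: this is the position (from 1) of the
   word x when words are ordered by length and then lexicographically.         *)
Definition position (x : seq bool) : nat :=
  foldl (fun k (a : bool) => (2 * k + a)%N) 1%N x.

Lemma position_rcons x a : position (rcons x a) = (2 * position x + a)%N.
Proof. by rewrite /position foldl_rcons. Qed.

Lemma position_bounds x :
  (2 ^ size x <= position x < 2 ^ (size x).+1)%N.
Proof.
elim/last_ind: x => [|x a IH] //.
by rewrite position_rcons size_rcons !expnS in IH *; case: a; lia.
Qed.

Lemma position_size x y : (size x < size y)%N -> (position x < position y)%N.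
Proof.
move=> lt_xy; have /andP[_ hx] := position_bounds x.
have /andP[hy _] := position_bounds y.
by apply: leq_trans hx (leq_trans _ hy); rewrite leq_exp2l.
Qed.

Lemma position_lex p u v : size u = size v ->
  (position (p ++ false :: u) < position (p ++ true :: v))%N.
Proof.
elim/last_ind: u v => [|u a IH] v; case/lastP: v => [|v c] //;
  rewrite ?size_rcons //.
  by move=> _; rewrite !cats1 !position_rcons; lia.
move=> [/IH]; rewrite -!rcons_cons -!rcons_cat !position_rcons.
by case: a; case: c; lia.
Qed.

Lemma position_inj : injective position.
Proof.
elim/last_ind=> [|x a IH] y; case/lastP: y => [|y c] //.
- rewrite position_rcons {1}/position /= => h.
  by have := position_bounds y; have := expn_gt0 2 (size y); case: c h; lia.
- rewrite position_rcons {2}/position /= => h.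
  by have := position_bounds x; have := expn_gt0 2 (size x); case: a h; lia.
rewrite !position_rcons => h.
have -> : a = c by case: a h; case: c => //; lia.
by congr rcons; apply: IH; case: a h; case: c; lia.
Qed.

Lemma node_indexP n (x : node n) :
  (0 < n)%N -> ((position x).-1 < 2 ^ n - 1)%N.
Proof.
move=> n0; have /andP[h1 h2] := position_bounds x.
have : (2 ^ (size x).+1 <= 2 ^ n)%N.
  by rewrite leq_exp2l //; have := size_bseq x; lia.
by have := expn_gt0 2 (size x); lia.
Qed.

Definition node_index n (n0 : (0 < n)%N) (x : node n) : 'I_(2 ^ n - 1) :=
  Ordinal (node_indexP x n0).

Lemma node_indexS n (n0 : (0 < n)%N) (x : node n) :
  (node_index n0 x).+1 = position x.
Proof.
have := position_bounds x; have := expn_gt0 2 (size x); rewrite /=; lia.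
Qed.

Lemma position_surj k : (0 < k)%N -> exists x, position x = k.
Proof.
elim/ltn_ind: k => k IH k0; have [k1 | k1] := leqP k 1.
  by exists [::]; rewrite /position /=; lia.
have [||x hx] := IH k./2; [lia | lia |].
by exists (rcons x (odd k)); rewrite position_rcons hx; lia.
Qed.

Lemma node_index_bij n (n0 : (0 < n)%N) : bijective (node_index n0).
Proof.
have inj : injective (node_index n0).
  move=> x y /(congr1 (fun i : 'I__ => (val i).+1)).
  by rewrite !node_indexS => /position_inj/val_inj.
have surj i : exists x, node_index n0 x == i.
  have [x hx] := @position_surj i.+1 isT.
  have sx : (size x <= n.-1)%N.
    have /andP[h _] := position_bounds x.
    have : (2 ^ size x < 2 ^ n)%N by have := ltn_ord i; lia.
    by rewrite ltn_exp2l //; lia.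
  by exists (Bseq sx); apply/eqP/val_inj => /=; rewrite hx.
exists (fun i => xchoose (surj i)) => [x|i].
  by apply: inj; apply/eqP; exact: (xchooseP (surj _)).
by apply/eqP; exact: (xchooseP (surj _)).
Qed.

Lemma position_child n (x : node n) a : (size x < n.-1)%N ->
  position (child x a) = (2 * position x + a)%N.
Proof.
by move=> sx; rewrite /child /insub_bseq val_insubd size_rcons sx position_rcons.
Qed.

Lemma eq_position n (x y : node n) : (x == y) = (position x == position y).
Proof. by rewrite (inj_eq position_inj). Qed.

Lemma sum_pick (m n : nat) (t : config m n) (c : int) (z : node n) :
  \sum_y (c *+ (y == z))%:~R * t y = c%:~R * t z.
Proof.
rewrite (bigD1 z) //= eqxx big1 ?addr0 // => y /negPf ->.
by rewrite mul0r.
Qed.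

(* tree_ca_mx is the matrix of the automaton in the ordering of the nodes by
   length and then lexicographically.                                          *)
Lemma tree_caE (m n : nat) (hm : (1 < m)%N) (hn : (1 < n)%N) (b c1 c2 : int)
    (t : config m n) (x : node n) :
  tree_ca b c1 c2 t x =
  \sum_(y : node n) (tree_ca_mx n b c1 c2 (node_index (ltnW hn) x)
                       (node_index (ltnW hn) y))%:~R * t y.
Proof.
rewrite ffunE /local_rule.
have /andP[lo hi] := position_bounds x; have p1 := expn_gt0 2 (size x).
have hn1 : (2 <= 2 ^ n.-1)%N by rewrite -{1}(expn1 2) leq_exp2l //; lia.
have [sx | sx] := ltnP.
  have h : (2 ^ (size x).+1 <= 2 ^ n.-1)%N by rewrite leq_exp2l.
  rewrite -!sum_pick -!big_split /=; apply: eq_bigr => y _.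
  rewrite -!mulrDl -!intrD; congr (_%:~R * _).
  rewrite mxE !node_indexS !eq_position !position_child //=.
  have q1 : (0 < position y)%N by rewrite -(node_indexS (ltnW hn)).
  have -> : (position x <= 2 ^ n.-1 - 1)%N by lia.
  have -> : (2 ^ n.-1 <= position x)%N = false by lia.
  rewrite !andbT andbF addn0 addn1.
  have [->|_] := eqVneq (position y) (position x).
    have -> : (position x == 2 * position x)%N = false by lia.
    have -> : (position x == (2 * position x).+1)%N = false by lia.
    by rewrite !addr0.
  have [->|_] := eqVneq (position y) (2 * position x)%N.
    have -> : (2 * position x == (2 * position x).+1)%N = false by lia.
    by rewrite add0r addr0.
  by case: eqP; rewrite !add0r.
have h : (2 ^ n.-1 <= 2 ^ size x)%N by rewrite leq_exp2l.
rewrite -!sum_pick -!big_split /=; apply: eq_bigr => y _.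
rewrite -!mulrDl -!intrD; congr (_%:~R * _).
rewrite mxE !node_indexS !eq_position /=.
have -> : (position x <= 2 ^ n.-1 - 1)%N = false by lia.
have -> : (2 ^ n.-1 <= position x)%N by lia.
rewrite !andbF andbT [position (root n)]/position /=.
have [->|_] := eqVneq (position y) (position x).
  have -> : (position x == 1)%N = false by lia.
  by rewrite !addr0.
by case: eqP; rewrite ?add0r ?addr0.
Qed.

(* Main.v *)
(* Write s = c1 + c2.  The vector w that is b ^ (n - 1) at the root and
   (-s) ^ (n - k) * b ^ (k - 1) at the nodes of level k >= 1 is mapped by T_n to
   (b ^ n - (-s) ^ n) times the unit vector of the root.  Replacing the first
   column of T_n by T_n w therefore makes it upper triangular, which gives
   b ^ (n - 1) * det T_n = (b ^ n - (-s) ^ n) * b ^ (2 ^ n - 2).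
   If b = 0, two leaves give equal rows and both sides vanish. *)
Require Import Defs.
From mathcomp Require Import all_boot all_order all_algebra.
From mathcomp Require Import zify ring.
Import Order.TTheory GRing.Theory Num.Theory.
Local Open Scope ring_scope.

(** Right multiplication by this matrix replaces the first column of [A] by [A w] and keeps the
    others, at the cost of a factor [w 1] in the determinant. The argument of [w] is a position
    counted from 1. *)
Definition first_col_mx {R : pzRingType} N (w : nat -> R) : 'M[R]_N :=
  \matrix_(i, j) if j == 0 :> nat then w i.+1 else (i == j)%:R.

Lemma prod_first_const (R : comPzRingType) N (x y : R) : (0 < N)%N ->
  \prod_(i < N) (if i == 0 :> nat then x else y) = x * y ^+ N.-1.
Proof.
move=> N0; rewrite -(big_mkord xpredT (fun i => if i == 0 then x else y)).
rewrite big_ltn //= (eq_big_nat _ _ (F2 := fun=> y)).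
  by rewrite prodr_const_nat subn1.
by case.
Qed.

Lemma det_first_col_mx (R : comPzRingType) N (w : nat -> R) : (0 < N)%N ->
  \det (first_col_mx N w) = w 1.
Proof.
move=> N0; rewrite det_trig.
  rewrite (eq_bigr (fun i : 'I_N => if i == 0 :> nat then w 1 else 1)).
    by rewrite prod_first_const // expr1n mulr1.
  by move=> i _; rewrite mxE eqxx; case: eqP => // ->.
apply/is_trig_mxP => i j ij; rewrite mxE -val_eqE /=.
by rewrite (ltn_eqF ij) (gtn_eqF (leq_ltn_trans _ ij)).
Qed.

Lemma mul_first_col_mxE (R : pzRingType) N (A : 'M[R]_N) (w : nat -> R) i j :
  (A *m first_col_mx N w) i j =
  if j == 0 :> nat then \sum_k A i k * w k.+1 else A i j.
Proof.
rewrite mxE; case: ifP => j0; first by apply: eq_bigr => k _; rewrite mxE j0.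
rewrite (bigD1 j) //= mxE j0 eqxx mulr1 big1 ?addr0 // => k /negPf kj.
by rewrite mxE j0 kj mulr0.
Qed.

Lemma sum_pick_succ (R : pzRingType) N (c : R) (w : nat -> R) k :
  (0 < k <= N)%N -> \sum_(j < N) (c *+ (j.+1 == k)) * w j.+1 = c * w k.
Proof.
case: k => // k kN; rewrite (bigD1 (Ordinal kN)) //= eqxx big1 ?addr0 // => j.
by rewrite -val_eqE /= eqSS => /negPf ->; rewrite mul0r.
Qed.

Section TreeDeterminant.

Context (n : nat) (hn : (2 <= n)%N) (b c1 c2 : int).

Let s := c1 + c2.
Let T := tree_ca_mx n b c1 c2.

Let pow_n : (2 ^ n = 2 * 2 ^ n.-1)%N.
Proof. by rewrite -expnS prednK // ltnW. Qed.

Let pow_n1 : (2 <= 2 ^ n.-1)%N.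
Proof. by rewrite -{1}(expn1 2) leq_exp2l //; lia. Qed.

(** The positions i, 2i and 2i + 1 are distinct, so the nested tests defining an entry amount to a
    sum of three indicators. *)
Lemma tree_ca_mx_mul_internal (w : nat -> int) (i : 'I_(2 ^ n - 1)) :
  (i.+1 < 2 ^ n.-1)%N ->
  \sum_j T i j * w j.+1 =
  b * w i.+1 + c1 * w (2 * i.+1)%N + c2 * w (2 * i.+1).+1.
Proof.
move=> hi; rewrite -!(@sum_pick_succ _ (2 ^ n - 1)); try lia.
rewrite -!big_split /=; apply: eq_bigr => j _; rewrite -!mulrDl mxE /=.
congr (_ * _).
have -> : (i < 2 ^ n.-1 - 1)%N by lia.
have -> : (2 ^ n.-1 <= i.+1)%N = false by lia.
rewrite !andbT andbF.
have [->|_] := eqVneq j.+1 i.+1.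
  have -> : (i.+1 == 2 * i.+1)%N = false by lia.
  have -> : (i.+1 == (2 * i.+1).+1)%N = false by lia.
  by rewrite !addr0.
have [->|_] := eqVneq j.+1 (2 * i.+1)%N.
  have -> : (2 * i.+1 == (2 * i.+1).+1)%N = false by lia.
  by rewrite add0r addr0.
by case: eqP; rewrite !add0r.
Qed.

Lemma tree_ca_mx_mul_leaf (w : nat -> int) (i : 'I_(2 ^ n - 1)) :
  (2 ^ n.-1 <= i.+1)%N -> \sum_j T i j * w j.+1 = b * w i.+1 + s * w 1.
Proof.
move=> hi; rewrite -!(@sum_pick_succ _ (2 ^ n - 1)); try by have := ltn_ord i; lia.
rewrite -!big_split /=; apply: eq_bigr => j _; rewrite -!mulrDl mxE /=.
congr (_ * _).
have -> : (i < 2 ^ n.-1 - 1)%N = false by lia.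
rewrite hi !andbF andbT.
have [->|_] := eqVneq j.+1 i.+1; last by case: eqP; rewrite add0r.
(* As n >= 2, the root is no leaf: [b] and [s] never compete for one column. *)
have -> : (i.+1 == 1)%N = false by lia.
by rewrite addr0.
Qed.

(* The node in position k >= 1 has level trunc_log 2 k. *)
Definition root_preimage (k : nat) : int :=
  if k == 1 then b ^+ n.-1
  else (- s) ^+ (n - trunc_log 2 k) * b ^+ (trunc_log 2 k).-1.

(** From a level k >= 1 to the next, the weight trades a factor -s for a factor b, so the [b] term
    and the [s] term cancel. A leaf wraps around to the root, whose weight b^(n-1) is what the
    formula would give at level n. *)
Lemma tree_ca_mx_root_preimage (i : 'I_(2 ^ n - 1)) :
  \sum_j T i j * root_preimage j.+1 =
  if i == 0 :> nat then b ^+ n - (- s) ^+ n else 0.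
Proof.
have [hi|hi] := ltnP i.+1 (2 ^ n.-1).
  rewrite tree_ca_mx_mul_internal // /root_preimage.
  have -> : (2 * i.+1 == 1)%N = false by lia.
  have -> : ((2 * i.+1).+1 == 1)%N = false by lia.
  have logd : trunc_log 2 (2 * i.+1) = (trunc_log 2 i.+1).+1.
    by rewrite mul2n trunc_log2_double.
  have logS : trunc_log 2 (2 * i.+1).+1 = (trunc_log 2 i.+1).+1.
    by rewrite trunc_log2S //; congr (trunc_log 2 _).+1; lia.
  rewrite logd logS -addrA -mulrDl -/s.
  (* In the root row both children have weight (-s)^(n-1), which leaves b^n + s (-s)^(n-1). *)
  have [i0|i0] := eqVneq (i : nat) 0%N.
    rewrite i0 /= trunc_log1 -exprS prednK ?(ltnW hn) // expr0 mulr1 subn1.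
    by rewrite -[in (- s) ^+ n](prednK (ltnW hn)) exprS mulNr opprK.
  have -> : (i.+1 == 1) = false by lia.
  have l0 : (0 < trunc_log 2 i.+1)%N by rewrite trunc_log_gt0; lia.
  have ln : (trunc_log 2 i.+1 < n)%N.
    by rewrite -(@ltn_exp2l 2) //; apply: leq_ltn_trans (trunc_logP _ _) _; lia.
  rewrite -(subnSK ln); case: (trunc_log 2 i.+1) l0 => // k _ /=.
  by rewrite !exprS; ring.
rewrite tree_ca_mx_mul_leaf // /root_preimage.
have -> : (i == 0 :> nat) = false by lia.
have -> : (i.+1 == 1) = false by lia.
have -> : trunc_log 2 i.+1 = n.-1.
  by apply: trunc_log_eq => //; have := ltn_ord i; rewrite hi prednK /=; lia.
have -> : (n - n.-1 = 1)%N by lia.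
have [k nk] : exists k, n = k.+2 by exists n.-2; lia.
by rewrite nk eqxx expr1 /= [b ^+ k.+1]exprS; ring.
Qed.

Lemma det_tree_ca_mx_mul :
  b ^+ n.-1 * \det T = (b ^+ n - (- s) ^+ n) * b ^+ (2 ^ n - 2).
Proof.
have N0 : (0 < 2 ^ n - 1)%N by lia.
have <- : \det (first_col_mx (2 ^ n - 1) root_preimage) = b ^+ n.-1.
  by rewrite det_first_col_mx.
have -> : (2 ^ n - 2 = (2 ^ n - 1).-1)%N by lia.
(* The transpose is taken because [det_trig] expects a lower triangular matrix. *)
rewrite mulrC -det_mulmx -prod_first_const // -det_tr det_trig.
  apply: eq_bigr => i _; rewrite mxE mul_first_col_mxE.
  case: ifP => i0; first by rewrite tree_ca_mx_root_preimage i0.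
  by rewrite mxE /= eqxx.
apply/is_trig_mxP => j i ji; rewrite mxE mul_first_col_mxE.
case: ifP => j0.
  by rewrite tree_ca_mx_root_preimage (gtn_eqF (leq_ltn_trans _ ji)).
(* Here j < i excludes the columns of the node and its children, and wrap-around entries lie only in
   the first column. *)
rewrite mxE /=.
have -> : (j.+1 == i.+1) = false by lia.
have -> : (j.+1 == 2 * i.+1)%N = false by lia.
have -> : (j.+1 == (2 * i.+1).+1)%N = false by lia.
by rewrite eqSS j0.
Qed.

Lemma det_tree_ca_mx_b0 : b = 0 -> \det T = 0.
Proof.
move=> b0.
(* Indices from 0 of the last two nodes, both leaves since n >= 2. *)
have h1 : (2 ^ n - 2 < 2 ^ n - 1)%N by lia.
have h2 : (2 ^ n - 3 < 2 ^ n - 1)%N by lia.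
apply: (@determinant_alternate _ _ _ (Ordinal h1) (Ordinal h2)).
  by rewrite -val_eqE /=; lia.
move=> j; rewrite !mxE /= b0.
have -> : (2 ^ n - 2 < 2 ^ n.-1 - 1)%N = false by lia.
have -> : (2 ^ n - 3 < 2 ^ n.-1 - 1)%N = false by lia.
have -> : (2 ^ n.-1 <= (2 ^ n - 2).+1)%N by lia.
have -> : (2 ^ n.-1 <= (2 ^ n - 3).+1)%N by lia.
rewrite !andbF !andbT.
have [->|_] := eqVneq j.+1 1; last by rewrite !if_same.
have -> : (1 == (2 ^ n - 2).+1)%N = false by lia.
by have -> : (1 == (2 ^ n - 3).+1)%N = false by lia.
Qed.

End TreeDeterminant.

Theorem theorem2p3 (n : nat) (hn : (2 <= n)%N) (b c1 c2 : int) :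
  \det (tree_ca_mx n b c1 c2) =
  (-1) ^+ (2 ^ n - n - 1)%N * (b + c1 + c2) * b ^+ (2 ^ n - n - 1)%N *
  (\sum_(0 <= j < n) (-1) ^+ j * (c1 + c2) ^+ (n - 1 - j)%N * b ^+ j).
Proof.
(* This makes the exponent of b positive, so that the right-hand side vanishes when b = 0. *)
have n_lt : (n.+1 < 2 ^ n)%N.
  by elim: n hn => // -[|[|k]] // IH _; rewrite expnS; have := IH isT; lia.
have [b0|b0] := eqVneq b 0.
  rewrite det_tree_ca_mx_b0 // b0 expr0n.
  have -> : (2 ^ n - n - 1 == 0)%N = false by lia.
  by rewrite mulr0 mul0r.
apply: (mulfI (expf_neq0 n.-1 b0)); rewrite det_tree_ca_mx_mul //.
(* The factorization of x^n - y^n at x = c1 + c2 and y = -b. *)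
have geom : (b + c1 + c2) *
    (\sum_(0 <= j < n) (-1) ^+ j * (c1 + c2) ^+ (n - 1 - j) * b ^+ j) =
    (c1 + c2) ^+ n - (- b) ^+ n.
  rewrite subrXX big_mkord opprK [c1 + c2 + b]addrC addrA; congr (_ * _).
  apply: eq_bigr => j _; rewrite [(- b) ^+ j]exprNn.
  have -> : (n - 1 - j = n.-1 - j)%N by lia.
  by ring.
(* Since 2^n is even, the exponent and n have opposite parities. *)
have sgn : (-1) ^+ (2 ^ n - n - 1) = - (-1) ^+ n :> int.
  rewrite -signr_odd -[in RHS]signr_odd.
  have -> : odd (2 ^ n - n - 1) = ~~ odd n.
    have e : (2 ^ n = 2 * 2 ^ n.-1)%N by rewrite -expnS prednK // ltnW.
    lia.
  by case: (odd n); rewrite ?opprK.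
rewrite sgn.
have -> : (2 ^ n - 2 = n.-1 + (2 ^ n - n - 1))%N by lia.
rewrite exprD [- (-1) ^+ n * _ * _ * _](_ : _ =
  - (-1) ^+ n * b ^+ (2 ^ n - n - 1) * ((c1 + c2) ^+ n - (- b) ^+ n)).
  rewrite [(- (c1 + c2)) ^+ n]exprNn [(- b) ^+ n]exprNn.
  (* With the sign abstracted as [e], writing b^n as e (e b^n) turns the goal into a polynomial
     identity for [ring]. *)
  have : (-1) ^+ n * (-1) ^+ n = 1 :> int by rewrite -exprMn mulrNN mulr1 expr1n.
  move: ((-1) ^+ n) => e ee.
  have eb : e * (e * b ^+ n) = b ^+ n by rewrite mulrA ee mul1r.
  by rewrite -[in LHS]eb; ring.
by rewrite -geom; ring.
Qed.
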